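(* Let $(M,\omega,\mathbb{T},\psi)$ be a compact symplectic toric manifold together with a choice of generic $\overline{\xi}\in\mathfrak{t}$ such that the corresponding moment map component $\mu=\langle\psi,\overline{\xi}\rangle\colon M\to\mathbb{R}$ is index increasing. Let $p\in M^{\mathbb{T}}$, let $\eta_p\in H^{2\lambda_p}_{\mathbb{T}}(M;\mathbb{Z})$ be the equivariant Poincaré dual to the flow-up manifold $F_p$, and let $\zeta_p\in H^{2\lambda_p}_{\mathbb{T}}(M;\mathbb{Z})$ be the GT-canonical class at $p$. Then $\eta_p=\zeta_p$.
   Context: Setting. A symplectic toric manifold $(M,\omega,\mathbb{T},\psi)$ of dimension $2n$ is a compact connected symplectic manifold $(M^{2n},\omega)$ with an effective Hamiltonian action of an $n$-dimensional torus $\mathbb{T}$ with Lie algebra $\mathfrak{t}$ and moment map $\psi\colon M\to\mathfrak{t}^*$ ($\mathbb{T}$-invariant, $\iota_{\xi^\#}\omega=-d\langle\psi,\xi\rangle$ for $\xi\in\mathfrak{t}$). The fixed point set $M^{\mathbb{T}}$ is discrete. Let $\ell^*\subset\mathfrak{t}^*$ be the weight lattice; $w\in\ell^*$ corresponds to the character $\exp(\xi)\mapsto e^{2\pi i w(\xi)}$. Let $J$ be a $\mathbb{T}$-invariant almost complex structure such that $\omega(J\cdot,\cdot)$ is an inner product; for $p\in M^{\mathbb{T}}$ let $W_p$ be the set of weights of the isotropy representation of $\mathbb{T}$ on $(T_pM,J)\simeq\mathbb{C}^n$; it is a $\mathbb{Z}$-basis of $\ell^*$. Generic component. $\overline{\xi}\in\mathfrak{t}$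 is generic if $w(\overline{\xi})\ne0$ for all isotropy weights $w\in\bigcup_pW_p$ and $\mu=\langle\psi,\overline{\xi}\rangle$ takes distinct values at distinct fixed points. Put $W_p^{\pm}=\{w\in W_p:\pm w(\overline{\xi})>0\}$ and $\lambda_p=|W_p^+|$. With these conventions $W_p^+$ is the set of weights on the negative normal bundle of the Morse function $\mu$ at $p$. GKM graph. $\Gamma=(V,E)$ has $V=M^{\mathbb{T}}$ (identified with the vertices of the polytope $\psi(M)$) and a directed edge $\overrightarrow{r\,q}$ in each direction for every edge of $\psi(M)$; $w(\overrightarrow{r\,q})\in\ell^*$ is the primitive element of $\ell^*$ with $\psi(q)-\psi(r)=m\,w(\overrightarrow{r\,q})$, $m>0$ (the weight at $q$ of the invariant sphere over that edge). $E^o\subset E$ is the set of edges $\overrightarrow{r\,q}$ with $\mu(r)<\mu(q)$. $\mu$ is index increasing if $\lambda_r<\lambda_q$ for every $\overrightarrow{r\,q}\in E^o$. Flow-up. $F_p=\psi^{-1}\big((\psi(p)+\mathrm{span}_{\mathbb{R}}W_p^-)\cap\psi(M)\big)$, a closed $\mathbb{T}$-invariant symplectic submanifold of dimension $2(n-\lambda_p)$. Equivariant cohomology. $H^*_{\mathbb{T}}(M;\mathbb{Z})=H^*(M\times_{\mathbb{T}}E\mathbb{T};\mathbb{Z})$; $H^*_{\mathbb{T}}(\mathrm{pt};\mathbb{Z})$ is the integral symmetric algebra of $\ell^*$ (with $\ell^*$ in degree 2). $\tau(q)$ is the restriction of $\tau\in H^*_{\mathbb{T}}(M;\mathbb{Z})$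 to $q\in M^{\mathbb{T}}$; restriction to $M^{\mathbb{T}}$ is injective. Poincaré dual. $\eta_p\in H^{2\lambda_p}_{\mathbb{T}}(M;\mathbb{Z})$ is the class with $\eta_p(q)=0$ for $q\in M^{\mathbb{T}}\setminus F_p$ and $\eta_p(q)=\prod_{r\in M^{\mathbb{T}}\setminus F_p,\ \overrightarrow{r\,q}\in E}w(\overrightarrow{r\,q})$ for $q\in F_p\cap M^{\mathbb{T}}$. GT-canonical class (Goldin–Tolman). $\zeta_p\in H^{2\lambda_p}_{\mathbb{T}}(M;\mathbb{Z})$ is a GT-canonical class at $p$ if $\zeta_p(p)=\Lambda_p^-:=\prod_{w\in W_p^+}w$ and $\zeta_p(q)=0$ for all $q\in M^{\mathbb{T}}\setminus\{p\}$ with $\lambda_q\le\lambda_p$. It is known that such a class is unique if it exists, and that it exists for every $p$ when $\mu$ is index increasing. *)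

(* Defs.v *)
From HB Require Import structures.
From mathcomp Require Import all_boot all_order all_algebra.
From mathcomp Require Import finmap.
From mathcomp Require Import generic_quotient ring_quotient.
From mathcomp Require Import all_classical all_reals all_analysis.
(* The notations of mpoly clash with those of mathcomp-analysis. *)
From mathcomp Require Import -(notations) mpoly.

Set Implicit Arguments.
Unset Strict Implicit.
Unset Printing Implicit Defensive.

Import Order.TTheory GRing.Theory Num.Theory numFieldNormedType.Exports.
Local Open Scope classical_set_scope.
Local Open Scope ring_scope.
Local Open Scope quotient_scope.

(* Lie algebra, lattice and torus.  A torus with a basis of its integral
   lattice l is T = t/l with t = 'rV[R]_n and l = 'rV[int]_n, and
   exp : t -> T is the projection.  Via the dual basis, t^* is 'rV[R]_n and the
   weight lattice l^* is 'rV[int]_n. *)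

Definition lat (R : realType) (n : nat) (z : 'rV[int]_n) : 'rV[R]_n :=
  map_mx intr z.

Lemma continuous_rV (R : realType) (n : nat) (X : topologicalType)
    (f : X -> 'rV[R]_n) :
  (forall i, continuous (fun x => f x 0 i)) -> continuous f.
Proof.
move=> fc x B [P Pf PB].
apply: (@filterS _ (nbhs x) _ [set y | forall i, P 0 i (f y 0 i)]).
  by move=> y Py; apply: PB => i j; rewrite (ord1 i).
by apply: filter_forall => i; apply: fc; exact: Pf.
Qed.

Lemma continuous_pair (X Y Z : topologicalType) (f : X -> Y) (g : X -> Z) :
  continuous f -> continuous g -> continuous (fun x => (f x, g x)).
Proof. by move=> cf cg x; exact: (cvg_pair (cf x) (cg x)). Qed.

Definition pairing (R : realType) (n : nat) (a xi : 'rV[R]_n) : R :=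
  \sum_i a 0 i * xi 0 i.

(* An action of T is an action of t in which l acts trivially. *)
Record torus_action (R : realType) (n : nat) (X : topologicalType) :=
  TorusAction {
    act :> 'rV[R]_n -> X -> X;
    act0 : forall x, act 0 x = x;
    actD : forall xi xi' x, act (xi + xi') x = act xi (act xi' x);
    act_lat : forall (z : 'rV[int]_n) x, act (lat R z) x = x;
    act_continuous : continuous (fun y : 'rV[R]_n * X => act y.1 y.2) }.

Definition fixed_points (R : realType) (n : nat) (X : topologicalType)
    (a : torus_action R n X) : set X :=
  [set x | forall xi, a xi x = x].

Section orbit_space.
Context (R : realType) (n : nat) (X : topologicalType).
Variable a : torus_action R n X.

Definition same_orbit : rel X := fun x y => `[< exists xi, y = a xi x >].

Lemma same_orbit_equiv : equiv_class_of same_orbit.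
Proof.
split=> [x|x y|y x z].
- by apply/asboolP; exists 0; rewrite act0.
- apply/asboolP/asboolP => -[xi ->]; exists (- xi);
  by rewrite -actD addNr act0.
- move=> /asboolP[xi ->] /asboolP[xi' ->]; apply/asboolP.
  by exists (xi' + xi); rewrite actD.
Qed.

Canonical same_orbit_rel := EquivRelPack same_orbit_equiv.

Definition orbit_space := quotient_topology {eq_quot same_orbit_rel}.

HB.instance Definition _ := Topological.on orbit_space.
HB.instance Definition _ := Quotient.on orbit_space.

Definition orbit_proj : X -> orbit_space := \pi_orbit_space.

Lemma orbit_proj_continuous : continuous orbit_proj.
Proof. exact: pi_continuous. Qed.

HB.instance Definition _ :=
  isContinuous.Build X orbit_space orbit_proj orbit_proj_continuous.

Lemma orbit_projP x y : reflect (exists xi, y = a xi x)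
  (orbit_proj x == orbit_proj y).
Proof.
apply: (iffP idP) => [/eqP /eqquotP/asboolP//|h].
by apply/eqP/eqquotP/asboolP.
Qed.

End orbit_space.

(* Singular cochains.  A cochain has components in all degrees, so that cup is
   defined without casts; of_degree k says that it lives in degree k. *)

Definition std_simplex (R : realType) (k : nat) : set 'rV[R]_k.+1 :=
  [set t | (forall i, 0 <= t 0 i) /\ \sum_i t 0 i = 1].
Arguments std_simplex : clear implicits.

Section simplex_map.
Context (R : realType) (j k : nat) (f : 'I_j.+1 -> 'I_k.+1).

(* The affine map of simplices with the map f on vertices. *)
Definition vertex_map (t : 'rV[R]_j.+1) : 'rV[R]_k.+1 :=
  \row_l \sum_(i | f i == l) t 0 i.

Lemma vertex_map_simplex t :
  std_simplex R j t -> vertex_map t \in std_simplex R k.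
Proof.
move=> [t0 t1]; apply/mem_set; split=> [l|].
  by rewrite mxE; apply: sumr_ge0.
rewrite -t1 [RHS](partition_big f xpredT)//=.
by apply: eq_bigr => l _; rewrite mxE.
Qed.

Definition simplex_map (t : std_simplex R j) : std_simplex R k :=
  exist _ (vertex_map (val t)) (vertex_map_simplex (set_mem (valP t))).

Lemma simplex_map_continuous : continuous simplex_map.
Proof.
apply: continuous_comp_initial => t.
apply: (@continuous_comp _ _ _ (set_val : std_simplex R j -> _) vertex_map).
  exact: initial_continuous.
apply: continuous_rV => l.
rewrite [X in continuous X](_ : _ = \sum_(i | f i == l) (fun y : 'rV_ _ => y 0 i)).
  apply: (big_ind (fun g : 'rV[R]_j.+1 -> R => continuous g)).
  - by move=> x; exact: cst_continuous.
  - by move=> g h cg ch x; apply: continuousD; [exact: cg|exact: ch].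
  - by move=> i _; exact: coord_continuous.
by apply/funext => y; rewrite mxE fct_sumE.
Qed.

HB.instance Definition _ :=
  isContinuous.Build (std_simplex R j) (std_simplex R k) simplex_map
    simplex_map_continuous.

End simplex_map.

Section cochains.
Context (R : realType) (X : topologicalType).

Definition singular (k : nat) := continuousType (std_simplex R k) X.

Definition cochain := {k : nat & singular k} -> int.

HB.instance Definition _ := GRing.Zmodule.on cochain.

Definition simp k (s : singular k) : {k : nat & singular k} := existT _ k s.

Definition sub_simplex j k (f : 'I_j.+1 -> 'I_k.+1) (s : singular k) :
  singular j := s \o simplex_map f.

Definition coboundary (a : cochain) : cochain := fun s =>
  let: existT k s := s in
  match k return singular k -> int with
  | 0%N => fun=> 0
  | k.+1 => fun s =>
      \sum_(i < k.+2) (-1) ^+ i * a (simp (sub_simplex (lift i) s))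
  end s.

Definition cup (a b : cochain) : cochain := fun s =>
  let: existT k s := s in
  \sum_(i < k.+1)
    a (simp (sub_simplex (fun j : 'I_i.+1 => inord j) s)) *
    b (simp (sub_simplex (fun j : 'I_(k - i).+1 => inord (i + j)) s)).

Definition cochain1 : cochain := fun s => (tag s == 0%N)%:R.

Definition of_degree (k : nat) (a : cochain) : Prop :=
  forall s, tag s <> k -> a s = 0.

Lemma coboundary_is_zmod_morphism : zmod_morphism coboundary.
Proof.
move=> a b; apply/funext => -[[|k] s]; rewrite /coboundary/=.
  by rewrite -[RHS]/(0 - 0) subr0.
rewrite -[RHS]/(_ - _) -sumrB; apply: eq_bigr => i _.
by rewrite -[(a - b) _]/(_ - _) mulrBr.
Qed.

HB.instance Definition _ :=
  GRing.isZmodMorphism.Build cochain cochain coboundary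
    coboundary_is_zmod_morphism.

Definition coboundaries : {pred cochain} :=
  fun a => `[< exists b, a = coboundary b >].

Lemma coboundaries_zmod_closed : zmod_closed coboundaries.
Proof.
split; first by apply/asboolP; exists 0; rewrite raddf0.
move=> a b /asboolP[a' ->] /asboolP[b' ->]; apply/asboolP.
by exists (a' - b'); rewrite raddfB.
Qed.

HB.instance Definition _ :=
  GRing.isZmodClosed.Build cochain coboundaries coboundaries_zmod_closed.

(* Cochains modulo coboundaries; H^k(X; Z) is the subset cohomology k. *)
Definition cochain_class := Quotient.quot (coboundaries : zmodClosed cochain).

HB.instance Definition _ := GRing.Zmodule.on cochain_class.
HB.instance Definition _ := Quotient.on cochain_class.

Definition class_of (a : cochain) : cochain_class := \pi_cochain_class a.

Lemma class_ofP a a' :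
  class_of a = class_of a' <-> exists b, a - a' = coboundary b.
Proof.
rewrite -[class_of a]/(\pi_(Quotient.quot _) a).
rewrite -[class_of a']/(\pi_(Quotient.quot _) a').
split=> [/eqP|h]; first by rewrite eqquotE Quotient.equivE => /asboolP.
by apply/eqP; rewrite eqquotE Quotient.equivE; apply/asboolP.
Qed.

Definition cohomology (k : nat) : set cochain_class :=
  [set x | exists a, [/\ of_degree k a, coboundary a = 0 & x = class_of a]].

End cochains.

Section pullback.
Context (R : realType) (X Y : topologicalType) (f : continuousType X Y).

Definition pullback (a : cochain R Y) : cochain R X :=
  fun s => a (simp (f \o tagged s)).

Lemma coboundary_pullback a :
  coboundary (pullback a) = pullback (coboundary a).
Proof.
apply/funext => -[[|k] s]//=; apply: eq_bigr => i _.
rewrite /pullback/=; congr (_ * a (simp _)).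
by apply/continuousEP.
Qed.

Definition pullback_class (x : cochain_class R Y) : cochain_class R X :=
  class_of (pullback (repr x)).

Lemma pullback_class_of a : pullback_class (class_of a) = class_of (pullback a).
Proof.
have /class_ofP[b eb] : class_of (repr (class_of a)) = class_of a.
  by rewrite /class_of reprK.
apply/class_ofP; exists (pullback b).
by rewrite coboundary_pullback -eb.
Qed.

End pullback.

Section borel.
Context (R : realType) (n : nat) (X E : topologicalType).
Variables (a : torus_action R n X) (e : torus_action R n E).

Definition diag_act (xi : 'rV[R]_n) (y : X * E) : X * E := (a xi y.1, e xi y.2).

Lemma diag_act_continuous :
  continuous (fun y : 'rV[R]_n * (X * E) => diag_act y.1 y.2).
Proof.
have fst_cts (Y Z : topologicalType) : continuous (@fst Y Z).
  by move=> y; exact: cvg_fst.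
have snd_cts (Y Z : topologicalType) : continuous (@snd Y Z).
  by move=> y; exact: cvg_snd.
have comp_cts (Y Z W : topologicalType) (f : Y -> Z) (g : Z -> W) :
    continuous f -> continuous g -> continuous (g \o f).
  by move=> cf cg y; apply: continuous_comp; [exact: cf|exact: cg].
apply: continuous_pair.
- apply: (comp_cts _ _ _ (fun y : 'rV[R]_n * (X * E) => (y.1, y.2.1))
    (fun z => a z.1 z.2)); last exact: act_continuous.
  apply: (continuous_pair (@fst_cts _ _)).
  exact: (comp_cts _ _ _ _ _ (@snd_cts _ _) (@fst_cts _ _)).
- apply: (comp_cts _ _ _ (fun y : 'rV[R]_n * (X * E) => (y.1, y.2.2))
    (fun z => e z.1 z.2)); last exact: act_continuous.
  apply: (continuous_pair (@fst_cts _ _)).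
  exact: (comp_cts _ _ _ _ _ (@snd_cts _ _) (@snd_cts _ _)).
Qed.

Definition diag_action : torus_action R n (X * E)%type.
Proof.
apply: (@TorusAction _ _ _ diag_act _ _ _ diag_act_continuous).
- by move=> [x y]; rewrite /diag_act !act0.
- by move=> xi xi' [x y]; rewrite /diag_act !actD.
- by move=> z [x y]; rewrite /diag_act !act_lat.
Defined.

(* X x_T E *)
Definition borel := orbit_space diag_action.

HB.instance Definition _ := Topological.on borel.

(* For a fixed point q, the map E/T = {q} x_T E -> X x_T E. *)
Definition borel_point (q : fixed_points a) (b : orbit_space e) : borel :=
  orbit_proj diag_action (val q, repr b).

Lemma borel_point_proj q y :
  borel_point q (orbit_proj e y) = orbit_proj diag_action (val q, y).
Proof.
have : orbit_proj e (repr (orbit_proj e y)) == orbit_proj e y.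
  by rewrite /orbit_proj reprK.
rewrite /borel_point; move: (repr _) => y' /orbit_projP[xi ->].
apply/eqP/orbit_projP; exists xi; rewrite /= /diag_act/=.
by have /set_mem -> := valP q.
Qed.

Lemma borel_point_continuous q : continuous (borel_point q).
Proof.
apply: (iffRL (@quotient_continuous _ {eq_quot same_orbit_rel e} _ _)).
rewrite [X in continuous X](_ : _ = orbit_proj diag_action \o pair (val q)); last first.
  by apply/funext => y /=; exact: borel_point_proj.
move=> y; apply: (@continuous_comp _ _ _ (pair (val q)) (orbit_proj diag_action)).
  by apply: continuous_pair => [z|z]; [exact: cvg_cst|exact: cvg_id].
exact: orbit_proj_continuous.
Qed.

HB.instance Definition _ (q : fixed_points a) :=
  isContinuous.Build (orbit_space e) borel (borel_point q)
    (@borel_point_continuous q).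

End borel.

(* A model E -> E/T of the universal principal T-bundle. *)
Record universal_bundle (R : realType) (n : nat) := UniversalBundle {
  ub_space :> topologicalType;
  ub_act : torus_action R n ub_space;
  ub_free : forall xi x, ub_act xi x = x -> exists z, xi = lat R z;
  ub_hausdorff : hausdorff_space ub_space;
  ub_contractible : exists (x0 : ub_space) (h : R * ub_space -> ub_space),
    [/\ {within `[0, 1]%classic `*` setT, continuous h},
        forall x, h (0, x) = x & forall x, h (1, x) = x0];
  ub_sections : forall b : orbit_space ub_act,
    exists2 s : orbit_space ub_act -> ub_space,
      (forall b', orbit_proj ub_act (s b') = b') &
      \forall b' \near b, {for b', continuous s} }.

Section equivariant_cohomology.
Context (R : realType) (n : nat) (E : universal_bundle R n).

Definition BT := orbit_space (ub_act E).

HB.instance Definition _ := Topological.on BT.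

Section orbit_path.
Variables (xi : 'rV[R]_n) (x : E).

Definition orbit_path (t : std_simplex R 1) : E :=
  ub_act E (val t 0 1 *: xi) x.

Lemma orbit_path_continuous : continuous orbit_path.
Proof.
have cts : continuous (fun c : R => ub_act E (c *: xi) x).
  have c1 : continuous (fun c : R => (c *: xi, x)).
    apply: continuous_pair => c; last exact: cvg_cst.
    exact: scalel_continuous.
  move=> c; apply: (@continuous_comp _ _ _ (fun c : R => (c *: xi, x))
    (fun y => ub_act E y.1 y.2)); first exact: c1.
  exact: act_continuous.
have c2 : continuous (fun t : std_simplex R 1 => val t 0 1).
  move=> t; apply: (@continuous_comp _ _ _ (set_val : std_simplex R 1 -> _)
    (fun u : 'rV[R]_2 => u 0 1)); first exact: initial_continuous.
  exact: coord_continuous.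
by move=> t; apply: (@continuous_comp _ _ _ _ (fun c : R => ub_act E (c *: xi) x));
  [exact: c2|exact: cts].
Qed.

HB.instance Definition _ :=
  isContinuous.Build (std_simplex R 1) E orbit_path orbit_path_continuous.

End orbit_path.

(* The identification of Sym l^* with H^*(BT; Z).  The class of the i-th coordinate
   character is c_1(E x_T C) for the corresponding representation of T on C.
   It is the transgression of the class in H^1(T; Z) with value z_i on the loop
   t |-> exp (t z), for z in l. *)
Definition represents_character (i : 'I_n) : set (cochain R BT) :=
  [set c | [/\ of_degree 2 c, coboundary c = 0 &
    exists a : cochain R E, [/\ of_degree 1 a,
      pullback (orbit_proj (ub_act E)) c = coboundary a &
      forall (z : 'rV[int]_n) (x : E),
        a (simp (orbit_path (lat R z) x)) = z 0 i]]].

Definition character_cocycle (i : 'I_n) : cochain R BT :=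
  xget 0 (represents_character i).

Definition sym_class (f : mpoly n int) : cochain_class R BT :=
  class_of (\sum_(m <- msupp f)
    (\big[@cup R BT/@cochain1 R BT]_(i < n)
       iter (m i) (cup (character_cocycle i)) (@cochain1 R BT)) *~ mcoeff m f).

Definition weight_poly (w : 'rV[int]_n) : mpoly n int :=
  \sum_i w 0 i *: mpolyX int (mnm1 i).

Variables (X : topologicalType) (a : torus_action R n X).

Definition restriction (tau : cochain_class R (borel a (ub_act E)))
    (q : fixed_points a) : cochain_class R BT :=
  pullback_class (@borel_point _ _ _ _ a (ub_act E) q) tau.

End equivariant_cohomology.

(* Smooth maps, manifolds and tensors in charts.  Tangent vectors are row
   vectors, so that differentials act by right multiplication by jacobians. *)

Section smooth.
Context (R : realType) (V W : normedModType R).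

Fixpoint Ck (k : nat) (U : set V) (f : V -> W) : Prop :=
  (forall x, U x -> {for x, continuous f}) /\
  if k is k.+1 then
    (forall x v, U x -> derivable f x v) /\ (forall v, Ck k U ('D_v f))
  else True.

Definition smooth_on (U : set V) (f : V -> W) : Prop := forall k, Ck k U f.

End smooth.

Record chart (R : realType) (d : nat) (M : topologicalType) := Chart {
  chart_fun :> M -> 'rV[R]_d;
  chart_inv : 'rV[R]_d -> M;
  chart_dom : set M;
  chart_dom_open : open chart_dom;
  chart_img_open : open (chart_fun @` chart_dom);
  chartK : forall x, chart_dom x -> chart_inv (chart_fun x) = x;
  chart_continuous : forall x, chart_dom x -> {for x, continuous chart_fun};
  chart_inv_continuous : forall x, chart_dom x ->
    {for chart_fun x, continuous chart_inv} }.

(* Second countability is omitted: only compact manifolds are considered. *)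
Record manifold (R : realType) (d : nat) := Manifold {
  mfd_space :> topologicalType;
  atlas : set (chart R d mfd_space);
  mfd_hausdorff : hausdorff_space mfd_space;
  atlas_cover : forall x, exists2 c, atlas c & chart_dom c x;
  atlas_smooth : forall c c', atlas c -> atlas c' ->
    smooth_on (c @` (chart_dom c `&` chart_dom c')) (c' \o chart_inv c) }.

(* f : M -> M in the charts c of the source and c' of the target *)
Definition in_charts (R : realType) (d : nat) (M : manifold R d)
    (c c' : chart R d M) (f : M -> M) : 'rV[R]_d -> 'rV[R]_d :=
  c' \o f \o chart_inv c.

Record toric_manifold (R : realType) (n : nat) := ToricManifold {
  tm_mfd :> manifold R (2 * n);
  tm_compact : compact [set: tm_mfd];
  tm_connected : connected [set: tm_mfd];

  tm_act : torus_action R n tm_mfd;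
  tm_act_smooth : forall c c', atlas c -> atlas c' ->
    smooth_on [set y | exists x, [/\ chart_dom c x,
                 chart_dom c' (tm_act y.1 x) & y.2 = c x]]
      (fun y : 'rV[R]_n * 'rV[R]_(2 * n) => c' (tm_act y.1 (chart_inv c y.2)));
  tm_effective : forall xi, (forall x, tm_act xi x = x) ->
    exists z, xi = lat R z;

  (* tm_omega c u is the matrix of the symplectic form at chart_inv c u *)
  tm_omega : chart R (2 * n) tm_mfd -> 'rV[R]_(2 * n) -> 'M[R]_(2 * n);
  tm_omega_smooth : forall c, atlas c ->
    smooth_on (c @` chart_dom c) (tm_omega c);
  tm_omega_skew : forall c x, atlas c -> chart_dom c x ->
    (tm_omega c (c x))^T = - tm_omega c (c x);
  tm_omega_nondegenerate : forall c x, atlas c -> chart_dom c x ->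
    tm_omega c (c x) \in unitmx;
  tm_omega_closed : forall c x (i j k : 'I_(2 * n)),
    atlas c -> chart_dom c x ->
    let om i j u := tm_omega c u i j in
    'D_(delta_mx 0 i) (om j k) (c x) + 'D_(delta_mx 0 j) (om k i) (c x) +
    'D_(delta_mx 0 k) (om i j) (c x) = 0;
  (* for xi = 0, this is compatibility with changes of charts *)
  tm_omega_invariant : forall xi c c' x, atlas c -> atlas c' ->
    chart_dom c x -> chart_dom c' (tm_act xi x) ->
    let D := 'J (in_charts c c' (tm_act xi)) (c x) in
    D *m tm_omega c' (c' (tm_act xi x)) *m D^T = tm_omega c (c x);

  tm_moment : tm_mfd -> 'rV[R]_n;
  tm_moment_smooth : forall c, atlas c ->
    smooth_on (c @` chart_dom c) (tm_moment \o chart_inv c);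
  tm_moment_invariant : forall xi x, tm_moment (tm_act xi x) = tm_moment x;
  (* omega (xi^#, v) = - d <psi, xi> (v) *)
  tm_moment_hamiltonian : forall c x (xi : 'rV[R]_n) (v : 'rV[R]_(2 * n)),
    atlas c -> chart_dom c x ->
    let xisharp := derive1 (fun s : R => c (tm_act (s *: xi) x)) 0 in
    (xisharp *m tm_omega c (c x) *m v^T) 0 0 =
      - 'D_v (fun u => pairing (tm_moment (chart_inv c u)) xi) (c x) }.

(* An invariant almost complex structure with omega (J v, w) an inner product *)
Record invariant_acs (R : realType) (n : nat) (M : toric_manifold R n) :=
  InvariantACS {
  acs :> chart R (2 * n) M -> 'rV[R]_(2 * n) -> 'M[R]_(2 * n);
  acs_smooth : forall c, atlas c -> smooth_on (c @` chart_dom c) (acs c);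
  acs_sqr : forall c x, atlas c -> chart_dom c x ->
    acs c (c x) *m acs c (c x) = - 1%:M;
  acs_invariant : forall xi c c' x, atlas c -> atlas c' ->
    chart_dom c x -> chart_dom c' (tm_act M xi x) ->
    let D := 'J (in_charts c c' (tm_act M xi)) (c x) in
    D *m acs c' (c' (tm_act M xi x)) = acs c (c x) *m D;
  acs_compatible : forall c x, atlas c -> chart_dom c x ->
    let g := acs c (c x) *m tm_omega c (c x) in
    g^T = g /\ forall v : 'rV[R]_(2 * n), v != 0 -> 0 < (v *m g *m v^T) 0 0 }.

Section toric.
Context (R : realType) (n : nat) (M : toric_manifold R n).
Local Notation psi := (@tm_moment R n M).

Definition fixpt := set_type (fixed_points (tm_act M)).

HB.instance Definition _ := Choice.on fixpt.

Definition mom (p : fixpt) : 'rV[R]_n := psi (val p).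

Definition weights (J : invariant_acs M) (p : fixpt) : set 'rV[int]_n :=
  [set w | exists (c : chart R (2 * n) M) (v : 'rV[R]_(2 * n)),
    [/\ atlas c, chart_dom c (val p), v != 0 &
      forall xi : 'rV[R]_n, let theta := 2 * pi * pairing (lat R w) xi in
        v *m 'J (in_charts c c (tm_act M xi)) (c (val p)) =
        cos theta *: v + sin theta *: (v *m J c (c (val p)))]].

Definition moment_polytope : set 'rV[R]_n := range psi.

Definition segment (a b : 'rV[R]_n) : set 'rV[R]_n :=
  [set x | exists2 s, 0 <= s <= 1 & x = a + s *: (b - a)].

Definition face (P F : set 'rV[R]_n) : Prop :=
  exists (alpha : 'rV[R]_n) (m : R),
    (forall x, P x -> pairing x alpha <= m) /\
    F = P `&` [set x | pairing x alpha = m].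

Definition edge (r q : fixpt) : Prop :=
  mom r != mom q /\ face moment_polytope (segment (mom r) (mom q)).

Definition primitive (w : 'rV[int]_n) : Prop :=
  w != 0 /\ forall (k : int) u, w = k *: u -> `|k| = 1.

Definition edge_weight (r q : fixpt) : 'rV[int]_n :=
  xget 0 [set w | primitive w /\
    exists2 m : R, 0 < m & mom q - mom r = m *: lat R w].

Variable J : invariant_acs M.

Definition convex_hull (A : set 'rV[R]_n) : set 'rV[R]_n :=
  [set y | exists (k : nat) (s : 'I_k -> R) (x : 'I_k -> 'rV[R]_n),
    [/\ forall i, 0 <= s i, \sum_i s i = 1, forall i, A (x i) &
        y = \sum_i s i *: x i]].

(* The convexity theorem of Atiyah and Guillemin-Sternberg, with the local
   normal form at fixed points that makes psi(M) a Delzant polytope. *)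
Definition delzant_polytope : Prop :=
  [/\ finite_set (fixed_points (tm_act M)),
      injective mom,
      moment_polytope = convex_hull (range mom) &
      forall p, exists e : 'I_n -> 'rV[int]_n,
        [/\ weights J p = range e, (\matrix_i e i) \in unitmx &
          \forall y \near mom p, moment_polytope y <->
            exists2 s : 'I_n -> R, (forall i, 0 <= s i) &
              y = mom p - \sum_i s i *: lat R (e i)]].

Variable xi : 'rV[R]_n.

Definition mu (p : fixpt) : R := pairing (mom p) xi.

Definition generic : Prop :=
  (forall p w, weights J p w -> pairing (lat R w) xi != 0) /\ injective mu.

Definition weights_pos (p : fixpt) : {fset 'rV[int]_n} :=
  fset_set [set w | weights J p w /\ 0 < pairing (lat R w) xi].

Definition weights_neg (p : fixpt) : {fset 'rV[int]_n} :=
  fset_set [set w | weights J p w /\ pairing (lat R w) xi < 0].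

Definition lambda (p : fixpt) : nat := #|` weights_pos p|.

Definition index_increasing : Prop :=
  forall r q, edge r q -> mu r < mu q -> (lambda r < lambda q)%N.

Definition flow_up (p : fixpt) : set M :=
  [set x | exists s : 'rV[int]_n -> R,
     psi x = mom p + \sum_(w <- weights_neg p) s w *: lat R w].

Variable E : universal_bundle R n.

Definition equivariant_class := cochain_class R (borel (tm_act M) (ub_act E)).

Definition poincare_dual (p : fixpt) (eta : equivariant_class) : Prop :=
  [/\ cohomology (2 * lambda p) eta,
      forall q : fixpt, ~ flow_up p (val q) -> restriction eta q = 0 &
      forall q : fixpt, flow_up p (val q) ->
        restriction eta q = sym_class E
          (\prod_(r <- fset_set [set r : fixpt | ~ flow_up p (val r) /\ edge r q])
             weight_poly (edge_weight r q))].

Definition GT_canonical (p : fixpt) (zeta : equivariant_class) : Prop :=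
  [/\ cohomology (2 * lambda p) zeta,
      restriction zeta p =
        sym_class E (\prod_(w <- weights_pos p) weight_poly w) &
      forall q, q != p -> (lambda q <= lambda p)%N -> restriction zeta q = 0].

End toric.

(* Main.v *)
(* Let e_i be the weights at a vertex p and d_i the dual basis of t.  The moment
   polytope lies in the cone psi(p) - sum_i R_{>=0} e_i, each ray in direction
   -e_i carries exactly one edge at p, and F_p is the face of the polytope on
   which the coordinates along W_p^+ vanish.  Hence at p the product defining
   eta_p runs over W_p^+.  Moreover p is the minimum of mu on F_p; a vertex
   q <> p of F_p has a mu-decreasing edge that stays in F_p, along which lambda
   drops because mu is index increasing, so by induction lambda_q > lambda_p.
   Thus eta_p vanishes wherever a GT-canonical class must, and uniqueness of
   that class concludes. *)
Require Import Defs.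
From mathcomp Require Import all_boot all_order all_algebra.
From mathcomp Require Import finmap ring lra.
From mathcomp Require Import all_classical all_reals all_analysis.
From mathcomp Require Import -(notations) mpoly.

Set Implicit Arguments.
Unset Strict Implicit.
Unset Printing Implicit Defensive.

Import Order.TTheory GRing.Theory Num.Theory numFieldNormedType.Exports.
Local Open Scope classical_set_scope.
Local Open Scope ring_scope.

(** * Bilinearity of the pairing and the lattice inside the real space *)

Lemma pairingE (R : realType) (n : nat) (x a : 'rV[R]_n) :
  pairing x a = (x *m a^T) 0 0.
Proof. by rewrite mxE; apply: eq_bigr => i _; rewrite !mxE. Qed.

Lemma pairingDl (R : realType) (n : nat) (x y a : 'rV[R]_n) :
  pairing (x + y) a = pairing x a + pairing y a.
Proof. by rewrite !pairingE mulmxDl mxE. Qed.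

Lemma pairingNl (R : realType) (n : nat) (x a : 'rV[R]_n) :
  pairing (- x) a = - pairing x a.
Proof. by rewrite !pairingE mulNmx mxE. Qed.

Lemma pairingZl (R : realType) (n : nat) (s : R) (x a : 'rV[R]_n) :
  pairing (s *: x) a = s * pairing x a.
Proof. by rewrite !pairingE -scalemxAl mxE. Qed.

Lemma pairing_suml (R : realType) (n : nat) (I : Type) (r : seq I)
    (P : pred I) (F : I -> 'rV[R]_n) (a : 'rV[R]_n) :
  pairing (\sum_(i <- r | P i) F i) a = \sum_(i <- r | P i) pairing (F i) a.
Proof.
by rewrite pairingE mulmx_suml summxE; apply: eq_bigr => i _; rewrite pairingE.
Qed.

Lemma pairing_sumr (R : realType) (n : nat) (I : Type) (r : seq I)
    (P : pred I) (F : I -> 'rV[R]_n) (x : 'rV[R]_n) :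
  pairing x (\sum_(i <- r | P i) F i) = \sum_(i <- r | P i) pairing x (F i).
Proof.
rewrite pairingE (raddf_sum (@trmx R 1 n)) mulmx_sumr summxE.
by apply: eq_bigr => i _; rewrite pairingE.
Qed.

Definition pairing_simp := (pairingDl, pairingNl, pairingZl).

Lemma lat_inj (R : realType) (n : nat) : injective (@lat R n).
Proof.
move=> u v /matrixP uv; apply/matrixP => i j; move: (uv i j).
by rewrite !mxE => /eqP; rewrite eqr_int => /eqP.
Qed.

Lemma latZ (R : realType) (n : nat) (c : int) (w : 'rV[int]_n) :
  lat R (c *: w) = c%:~R *: lat R w.
Proof. by apply/matrixP => i j; rewrite !mxE intrM. Qed.

(** * Dual bases of a unimodular family *)

Definition dual_bases (R : realType) (n : nat) (e : 'I_n -> 'rV[int]_n)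
    (d : 'I_n -> 'rV[int]_n) : Prop :=
  (forall i j, pairing (lat R (e j)) (lat R (d i)) = (i == j)%:R) /\
  (forall x : 'rV[R]_n, x = \sum_i pairing x (lat R (d i)) *: lat R (e i)).

(** The d_i are the columns of the inverse of the matrix B with rows e_i, integral since B is
    unimodular. Duality is B B^-1 = 1, the expansion is B^-1 B = 1. *)
Lemma dual_bases_exists (R : realType) (n : nat) (e : 'I_n -> 'rV[int]_n) :
  (\matrix_i e i) \in unitmx -> exists d : 'I_n -> 'rV[int]_n, dual_bases R e d.
Proof.
set B := \matrix_i e i => uB; set D := invmx B.
exists (fun i => \row_k D k i); split=> [i j|x].
  have /matrixP/(_ j i) := mulmxV uB.
  rewrite !mxE => /(congr1 (fun z : int => z%:~R : R)).
  rewrite rmorph_nat eq_sym => <-; rewrite rmorph_sum/=.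
  by apply: eq_bigr => k _; rewrite !mxE intrM.
apply/matrixP => i j; rewrite (ord1 i) summxE.
under eq_bigr => k _.
  rewrite !mxE /pairing mulr_suml.
  under eq_bigr => l _ do rewrite !mxE -mulrA -intrM.
  over.
rewrite exchange_big/=.
under eq_bigr => k _.
  rewrite -mulr_sumr -(rmorph_sum (intr : int -> R))/=.
  have -> : \sum_l D k l * e l 0 j = (D *m B) k j.
    by rewrite mxE; apply: eq_bigr => l _; rewrite !mxE.
  rewrite mulVmx// mxE.
  over.
rewrite (bigD1 j)//= eqxx mulr1 big1 ?addr0// => k /negbTE ->.
by rewrite mulr0.
Qed.

Lemma dual_bases_inj (R : realType) (n : nat) (e d : 'I_n -> 'rV[int]_n) :
  dual_bases R e d -> injective e.
Proof.
move=> [de _] i j eij; have := de j i.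
rewrite eij de eqxx; case: eqP => [//|_] /eqP.
by rewrite oner_eq0.
Qed.

Lemma pairing_dual (R : realType) (n : nat) (e d : 'I_n -> 'rV[int]_n)
    (s : 'I_n -> R) (i : 'I_n) :
  dual_bases R e d ->
  pairing (\sum_j s j *: lat R (e j)) (lat R (d i)) = s i.
Proof.
move=> [de _]; rewrite pairing_suml (bigD1 i)//= pairingZl de eqxx mulr1.
rewrite big1 ?addr0// => j ji.
by rewrite pairingZl de eq_sym (negbTE ji) mulr0.
Qed.

Lemma pairing_lat (R : realType) (n : nat) (u v : 'rV[int]_n) :
  exists c : int, pairing (lat R u) (lat R v) = c%:~R.
Proof.
exists (\sum_i u 0 i * v 0 i); rewrite rmorph_sum.
by apply: eq_bigr => i _; rewrite /= !mxE intrM.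
Qed.

(** * Small steps along a ray and maxima on finite sets *)

(** The bound t <= 1 keeps the point on the segment from x to x + v, hence inside a convex set
    containing both ends. *)
Lemma nbhs_ray (R : realType) (n : nat) (x v : 'rV[R]_n) (A : set 'rV[R]_n) :
  (\forall y \near x, A y) -> exists2 t : R, 0 < t <= 1 & A (x + t *: v).
Proof.
move=> Ax.
have cts : (x + t *: v) @[t --> (0 : R)] --> x.
  rewrite -[X in _ --> X](_ : x + 0 *: v = x); last by rewrite scale0r addr0.
  by apply: cvgD; [exact: cvg_cst|exact: scalel_continuous].
have near0 : \forall t \near (0 : R)^'+, A (x + t *: v).
  exact: (cvg_at_right_filter cts) Ax.
have gt0 := nbhs_right_gt (0 : R).
have le1 : \forall t \near (0 : R)^'+, t <= 1 by exact: nbhs_right_le.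
have [t [[At t0] t1]] := filter_ex (filterI (filterI near0 gt0) le1).
by exists t => //; apply/andP.
Qed.

Lemma finite_set_argmax (R : realType) (T : eqType) (A : set T) (f : T -> R) :
  finite_set A -> A !=set0 -> exists2 x, A x & forall y, A y -> f y <= f x.
Proof.
move=> /finite_seqP[s ->{A}] [x0 /= sx0].
suff [x sx max] : exists2 x, x \in s & {in s, forall y, f y <= f x}.
  by exists x.
case: s sx0 => // y s _ {x0}; elim: s y => [|z s IHs] y.
  by exists y; rewrite ?mem_seq1// => u; rewrite mem_seq1 => /eqP ->.
have [x xs max] := IHs z.
have [xy|yx] := leP (f x) (f y).
  exists y; first by rewrite mem_head.
  move=> u; rewrite inE => /predU1P[->//|us].
  exact: le_trans (max _ us) xy.
exists x; first by rewrite inE xs orbT.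
by move=> u; rewrite inE => /predU1P[->|/max//]; exact: ltW.
Qed.

Lemma mom_polytope (R : realType) (n : nat) (M : toric_manifold R n)
    (p : fixpt M) : moment_polytope M (mom p).
Proof. by exists (val p). Qed.

(** * Cones and faces of the moment polytope *)

Section delzant.
Context (R : realType) (n : nat) (M : toric_manifold R n).
Context (J : invariant_acs M) (hM : delzant_polytope J).
Local Notation P := (moment_polytope M).

Lemma mom_segment (p q : fixpt M) (s : R) : 0 <= s <= 1 ->
  P (mom p + s *: (mom q - mom p)).
Proof.
move=> /andP[s0 s1]; have [_ _ -> _] := hM.
exists 2%N, (fun i => if i == 0 then 1 - s else s).
exists (fun i => if i == 0 then mom p else mom q); split.
- by move=> i; case: ifP => _; rewrite ?subr_ge0.
- by rewrite !big_ord_recl big_ord0/= addr0 subrK.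
- by move=> i; case: ifP => _; [exists p|exists q].
- rewrite !big_ord_recl big_ord0/= addr0.
  by apply/matrixP => i j; rewrite !mxE; ring.
Qed.

Lemma finite_fixpt : finite_set [set: fixpt M].
Proof.
have [fin _ _ _] := hM.
suff -> : [set: fixpt M] = val @^-1` fixed_points (tm_act M).
  by apply: finite_preimage fin; exact: in2W val_inj.
by apply/seteqP; split=> // x _; exact: set_mem (valP x).
Qed.

(** The local normal form at p made global: the third clause puts the whole polytope in the cone at
    mom p, the fourth says that each ray of that cone starts inside the polytope. *)
Definition frame (p : fixpt M) (e d : 'I_n -> 'rV[int]_n) : Prop :=
  [/\ weights J p = range e, dual_bases R e d,
      forall x, P x -> forall i, 0 <= pairing (mom p - x) (lat R (d i)) &
      forall i, exists2 t : R, 0 < t & P (mom p - t *: lat R (e i))].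

(** The cone is given only near mom p. By convexity the segment from mom p to any mom q starts in
    it, which fixes the signs of the coordinates of mom p - mom q; these pass to the hull. *)
Lemma frame_exists p : exists e d, frame p e d.
Proof.
have [_ _ hull /(_ p)[e [We ue loc]]] := hM.
have [d de] := dual_bases_exists R ue.
exists e, d; split=> //.
  suff vert (q : fixpt M) i : 0 <= pairing (mom p - mom q) (lat R (d i)).
    move=> x; rewrite hull => -[k [s [y [s0 s1 yv ->]]]] i.
    have -> : mom p - \sum_j s j *: y j = \sum_j s j *: (mom p - y j).
      under [RHS]eq_bigr do rewrite scalerBr.
      by rewrite sumrB -scaler_suml s1 scale1r.
    rewrite pairing_suml; apply: sumr_ge0 => j _; rewrite pairingZl.
    by apply: mulr_ge0 => //; have [q _ <-] := yv j.
  (* At a small parameter t the i-th coordinate is t times that of mom p - mom q. *)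
  have [t /andP[t0 t1] [+ _]] := nbhs_ray (mom q - mom p) loc.
  case=> [|s s0 es]; first by apply: mom_segment; rewrite (ltW t0).
  have := congr1 (fun x => pairing (mom p - x) (lat R (d i))) es.
  rewrite subKr (pairing_dual _ _ de) => eq1.
  have := s0 i; rewrite -eq1 !pairing_simp => ge0.
  by rewrite -(pmulr_rge0 _ t0); move: ge0; lra.
move=> i; have [t /andP[t0 _] [_ h]] := nbhs_ray (- lat R (e i)) loc.
exists t => //; rewrite -scalerN; apply: h.
exists (fun j => if j == i then t else 0) => [j|].
  by case: ifP => // _; exact: ltW.
rewrite (bigD1 i)//= eqxx big1 ?addr0 ?scalerN// => j /negbTE ->.
by rewrite scale0r.
Qed.

(** A convex combination reaching the upper bound m of A gives weight zero to every vertex with A <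
    m, so bounds on the vertices of a face hold on the face. *)
Lemma face_hull (A : 'rV[R]_n) (m : R) (B : 'rV[R]_n) (c : R) :
  (forall x, P x -> pairing x A <= m) ->
  (forall q : fixpt M, pairing (mom q) A = m -> pairing (mom q) B <= c) ->
  forall x, P x -> pairing x A = m -> pairing x B <= c.
Proof.
move=> le vert x; have [_ _ hull _] := hM.
rewrite {1}hull => -[k [s [y [s0 s1 yv ->]]]] eqm.
have ym j : pairing (y j) A <= m.
  by have [q _ <-] := yv j; apply: le; exact: mom_polytope.
have sum0 : \sum_j s j * (m - pairing (y j) A) = 0.
  under eq_bigr do rewrite mulrBr.
  rewrite sumrB -mulr_suml s1 mul1r -eqm pairing_suml.
  by under [in X in _ - X]eq_bigr do rewrite -pairingZl; rewrite subrr.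
rewrite pairing_suml -[c]mul1r -s1 mulr_suml; apply: ler_sum => j _.
rewrite pairingZl.
have : s j * (m - pairing (y j) A) = 0.
  by apply: (psumr_eq0P _ sum0) => // l _; rewrite mulr_ge0// subr_ge0.
move=> /eqP; rewrite mulf_eq0 subr_eq0 => /orP[/eqP->|/eqP em].
  by rewrite !mul0r.
by apply: ler_wpM2l => //; have [q _ eq] := yv j; rewrite -eq vert// eq.
Qed.

(** * Edges at a vertex and their weights *)

(** The form A, the sum of the d_j with j != i, is maximal on the polytope exactly along the ray
    from mom p in direction -e_i. The face it cuts is a segment ending at the farthest fixed
    point. *)
Lemma edge_ray (p : fixpt M) e d i : frame p e d ->
  exists r t, [/\ 0 < t, mom r = mom p - t *: lat R (e i) & edge r p].
Proof.
move=> [_ [de ex] cone ray].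
pose A : 'rV[R]_n := \sum_(j | j != i) lat R (d j).
have onA x : P x -> pairing x A = pairing (mom p) A ->
    x = mom p - pairing (mom p - x) (lat R (d i)) *: lat R (e i).
  move=> Px xA.
  have sum0 : \sum_(j | j != i) pairing (mom p - x) (lat R (d j)) = 0.
    by rewrite -pairing_sumr !pairing_simp xA subrr.
  have -> : pairing (mom p - x) (lat R (d i)) *: lat R (e i) = mom p - x.
    rewrite [RHS]ex (bigD1 i)//= big1 ?addr0// => j ji.
    by rewrite (psumr_eq0P _ sum0) ?scale0r// => k _; exact: cone.
  by rewrite subKr.
have Ae c : pairing (c *: lat R (e i)) A = 0.
  rewrite pairingZl pairing_sumr big1 ?mulr0// => j ji.
  by rewrite de (negbTE ji).
have leA x : P x -> pairing x A <= pairing (mom p) A.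
  move=> Px; rewrite -subr_ge0 -pairingNl -pairingDl pairing_sumr.
  by apply: sumr_ge0 => j _; exact: cone.
have [r rA rmax] : exists2 r : fixpt M, pairing (mom r) A = pairing (mom p) A &
    forall q : fixpt M, pairing (mom q) A = pairing (mom p) A ->
      pairing (- mom q) (lat R (d i)) <= pairing (- mom r) (lat R (d i)).
  apply: (@finite_set_argmax R (fixpt M)
    [set q | pairing (mom q) A = pairing (mom p) A]
    (fun q => pairing (- mom q) (lat R (d i)))); last by exists p.
  exact: sub_finite_set finite_fixpt.
pose t := pairing (mom p - mom r) (lat R (d i)).
have er : mom r = mom p - t *: lat R (e i).
  by apply: onA => //; exact: mom_polytope.
have tmax x : P x -> pairing x A = pairing (mom p) A ->
    pairing (mom p - x) (lat R (d i)) <= t.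
  move=> Px xA; rewrite /t [X in X <= _]pairingDl [X in _ <= X]pairingDl lerD2l.
  have := @face_hull A _ (- lat R (d i)) (pairing (- mom r) (lat R (d i))) leA.
  have pairingNr (u v : 'rV[R]_n) : pairing u (- v) = pairing (- u) v.
    by rewrite !pairingE linearN/= mulmxN mulNmx.
  move=> /(_ _ x Px xA); rewrite pairingNr; apply=> q qA.
  by rewrite pairingNr; exact: rmax.
(* The ray contains a point of the polytope other than mom p, and t is the largest parameter. *)
have t0 : 0 < t.
  have [t' t'0 Pt'] := ray i; apply: lt_le_trans t'0 _.
  have := tmax _ Pt'; rewrite subKr pairingZl de eqxx mulr1; apply.
  by rewrite pairingDl pairingNl Ae subr0.
exists r, t; split=> //; split.
  apply/eqP => rp; move: t0; rewrite /t rp subrr.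
  by rewrite -(scale0r (0 : 'rV[R]_n)) pairingZl mul0r ltxx.
exists A, (pairing (mom p) A); split=> //.
apply/seteqP; split=> [_ [s s01 ->]|x [Px /= xA]].
  split; first exact: mom_segment.
  by rewrite /= !pairing_simp rA subrr mulr0 addr0.
have ec := onA x Px xA; have ct := tmax x Px xA.
have c0 := cone x Px i.
(* The segment has parameter 0 at mom r and 1 at mom p. *)
exists (1 - pairing (mom p - x) (lat R (d i)) / t).
  apply/andP; split; last by rewrite gerBl divr_ge0// ltW.
  by rewrite subr_ge0 ler_pdivrMr// mul1r.
rewrite {1}ec er subKr scalerA mulrBl mul1r divfK ?gt_eqF//.
by apply/matrixP => k l; rewrite !mxE; ring.
Qed.

(** The form A supporting the edge is nonnegative on each e_i and zero on mom p - mom r, whose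
    coordinates are nonnegative. A positive i-th coordinate thus forces A to vanish on e_i, so the
    neighbour along -e_i lies on this same edge, which is parallel to e_i. *)
Lemma edge_frame (p r : fixpt M) e d : frame p e d -> edge r p ->
  exists i t, 0 < t /\ mom r = mom p - t *: lat R (e i).
Proof.
move=> fr [rp [A [m [leA seg]]]].
have [_ [de ex] cone _] := fr.
have onm x : segment (mom r) (mom p) x -> pairing x A = m.
  by rewrite seg => -[].
have rm : pairing (mom r) A = m.
  by apply: onm; exists 0; rewrite ?lexx ?ler01// scale0r addr0.
have pm : pairing (mom p) A = m.
  by apply: onm; exists 1; rewrite ?lexx ?ler01// scale1r addrC subrK.
pose c i := pairing (mom p - mom r) (lat R (d i)).
have erp : mom p - mom r = \sum_i c i *: lat R (e i) by exact: ex.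
have c0 i : 0 <= c i by apply: cone; exact: mom_polytope.
have Ae i : 0 <= pairing (lat R (e i)) A.
  have [q [t [t0 eq _]]] := edge_ray i fr.
  have := leA _ (mom_polytope q); rewrite eq !pairing_simp pm.
  by rewrite gerBl pmulr_rge0.
have sum0 : \sum_i c i * pairing (lat R (e i)) A = 0.
  under eq_bigr do rewrite -pairingZl.
  by rewrite -pairing_suml -erp !pairing_simp pm rm subrr.
have [i ci] : exists i, 0 < c i.
  apply: contrapT => no; move: rp.
  rewrite eq_sym -subr_eq0 erp big1 ?eqxx// => i _.
  have /eqP -> : c i == 0; last by rewrite scale0r.
  by rewrite eq_le c0 andbT leNgt; apply/negP => ci; apply: no; exists i.
have Aei : pairing (lat R (e i)) A = 0.
  have /eqP : c i * pairing (lat R (e i)) A = 0.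
    by apply: (psumr_eq0P _ sum0) => // j _; exact: mulr_ge0.
  by rewrite mulf_eq0 gt_eqF// => /eqP.
have [q [t [t0 eq _]]] := edge_ray i fr.
have [s _ es] : segment (mom r) (mom p) (mom q).
  rewrite seg; split; first exact: mom_polytope.
  by rewrite /= eq !pairing_simp Aei mulr0 subr0.
have eti : t *: lat R (e i) = (1 - s) *: (mom p - mom r).
  have -> : t *: lat R (e i) = mom p - mom q by rewrite eq subKr.
  by rewrite es; apply/matrixP => k l; rewrite !mxE; ring.
(* Otherwise mom q would equal mom p. *)
have s1 : 1 - s != 0.
  apply/eqP => s1; have := congr1 (fun x => pairing x (lat R (d i))) eti.
  rewrite s1 !pairingZl de eqxx mulr1 mul0r => t00.
  by rewrite t00 ltxx in t0.
have erpi : mom p - mom r = ((1 - s)^-1 * t) *: lat R (e i).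
  by rewrite -scalerA eti scalerA mulVf// scale1r.
exists i, ((1 - s)^-1 * t); split; last by rewrite -erpi subKr.
by have := ci; rewrite /c erpi pairingZl de eqxx mulr1.
Qed.

(** The face carrying one edge contains the far end of the other, so neither is longer than the
    other; [mom] is injective. *)
Lemma edge_ray_inj (p r r' : fixpt M) e d i t t' : frame p e d ->
  edge r p -> edge r' p ->
  mom r = mom p - t *: lat R (e i) -> mom r' = mom p - t' *: lat R (e i) ->
  0 < t -> 0 < t' -> r = r'.
Proof.
move=> [_ [de _] _ _] rp r'p er er' t0 t'0.
have [_ inj _ _] := hM; apply: inj.
suff le (q q' : fixpt M) u u' : edge q p -> mom q = mom p - u *: lat R (e i) ->
    mom q' = mom p - u' *: lat R (e i) -> 0 < u -> u' <= u.
  by rewrite er er'; congr (_ - _ *: _); apply/eqP; rewrite eq_le;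
    apply/andP; split; [exact: (le r' r)|exact: (le r r')].
move=> [_ [A [m [leA seg]]]] eq eq' u0.
have onm x : segment (mom q) (mom p) x -> pairing x A = m.
  by rewrite seg => -[].
have qm : pairing (mom q) A = m.
  by apply: onm; exists 0; rewrite ?lexx ?ler01// scale0r addr0.
have pm : pairing (mom p) A = m.
  by apply: onm; exists 1; rewrite ?lexx ?ler01// scale1r addrC subrK.
have Aei : pairing (lat R (e i)) A = 0.
  have := qm; rewrite eq !pairing_simp pm => /eqP.
  rewrite -subr_eq0 addrC addrA addNr add0r oppr_eq0 mulf_eq0 gt_eqF//.
  by move=> /eqP.
have [s /andP[s0 _] es] : segment (mom q) (mom p) (mom q').
  rewrite seg; split; first exact: mom_polytope.
  by rewrite /= eq' !pairing_simp Aei mulr0 subr0.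
have : u' *: lat R (e i) = (1 - s) *: (u *: lat R (e i)).
  have -> : u' *: lat R (e i) = mom p - mom q' by rewrite eq' subKr.
  have -> : u *: lat R (e i) = mom p - mom q by rewrite eq subKr.
  by rewrite es; apply/matrixP => k l; rewrite !mxE; ring.
move=> /(congr1 (fun x => pairing x (lat R (d i)))).
rewrite !pairingZl de eqxx !mulr1 => ->.
by rewrite ger_pMl// gerBl.
Qed.

(** Pairing to 1 with the integral d_i makes e_i primitive. Another primitive w on the ray is c e_i
    with c its integral, positive pairing with d_i, whence c = 1. *)
Lemma edge_weight_frame (p r : fixpt M) e d i t : frame p e d -> 0 < t ->
  mom r = mom p - t *: lat R (e i) -> edge_weight r p = e i.
Proof.
move=> [_ [de _] _ _] t0 er.
have int1 (k c : int) : k * c = 1 -> `|k| = 1.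
  move=> /(congr1 absz)/eqP; rewrite abszM muln_eq1 => /andP[/eqP k1 _].
  by rewrite -abszE k1.
apply: xget_unique.
  split; last by exists t; rewrite // er subKr.
  split.
    apply/eqP => ei0; have := de i i; rewrite ei0 eqxx -(scale0r (0 : 'rV_n)).
    by rewrite latZ pairingZl mul0r => /esym/eqP; rewrite oner_eq0.
  move=> k u ek; have [c ec] := pairing_lat R u (d i).
  have := de i i; rewrite ek latZ pairingZl ec eqxx -intrM => /eqP.
  by rewrite -[1%:R]/((1 : int)%:~R) eqr_int => /eqP; exact: int1.
move=> w [[_ prim] [m m0]]; rewrite er subKr => ew.
have [c ec] := pairing_lat R w (d i).
have em : t = m * c%:~R.
  have := congr1 (fun x => pairing x (lat R (d i))) ew.
  by rewrite !pairingZl de eqxx mulr1 ec.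
have wc : w = c *: e i.
  apply: (@lat_inj R); rewrite latZ.
  apply: (scalerI (lt0r_neq0 m0)).
  by rewrite -ew scalerA em.
have c0 : 0 < c by move: t0; rewrite em pmulr_rgt0// ltr0z.
by have := prim _ _ wc; rewrite gtr0_norm// => c1; rewrite wc c1 scale1r.
Qed.

(** * The flow-up as a face and the growth of the index on it *)

Context (xi : 'rV[R]_n) (hgen : generic J xi).

Lemma mem_weightsP (p : fixpt M) e d (Q : set 'rV[int]_n) w : frame p e d ->
  reflect (exists2 i, w = e i & Q (e i))
    (w \in fset_set [set w | weights J p w /\ Q w]).
Proof.
move=> [We _ _ _]; rewrite in_fset_set; last first.
  apply: (@sub_finite_set _ _ (range e)) => [v []|]; first by rewrite We.
  exact: finite_image.
apply: (iffP idP) => [/set_mem[]|[i -> Qi]].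
  by rewrite We => -[i _ <-] Qi; exists i.
by apply/mem_set; split; rewrite ?We//; exists i.
Qed.

Lemma frame_neq0 (p : fixpt M) e d i : frame p e d ->
  pairing (lat R (e i)) xi != 0.
Proof. by move=> [We _ _ _]; apply: hgen.1 (p) _ _; rewrite We; exists i. Qed.

(** By genericity every weight at p is in W_p^+ or W_p^-, so the span of W_p^- is where the
    coordinates along W_p^+ vanish. *)
Lemma flow_upP (p q : fixpt M) e d : frame p e d ->
  flow_up J xi p (val q) <-> forall i, 0 < pairing (lat R (e i)) xi ->
    pairing (mom p - mom q) (lat R (d i)) = 0.
Proof.
move=> fr; have [_ de _ _] := fr; have e_inj := dual_bases_inj de.
have [dual ex] := de; rewrite /flow_up /= -/(mom q); split.
  move=> [s ->] i ei; rewrite opprD addrA subrr add0r pairingNl pairing_suml.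
  rewrite big_seq big1 ?oppr0// => w /(mem_weightsP _ _ fr)[j -> ej].
  rewrite pairingZl dual.
  by case: eqP => [ij|]; rewrite ?mulr0//; move: ej; rewrite -ij ltNge ltW.
move=> h; pose c i := pairing (mom p - mom q) (lat R (d i)).
(* Summing over the fibre of [e] turns coefficients indexed by i into a function of the weight; the
   sign comes from using mom p - mom q. *)
exists (fun w => - \sum_(i | e i == w) c i).
have -> : \sum_(w <- weights_neg J xi p)
      - (\sum_(i | e i == w) c i) *: lat R w =
    - \sum_i c i *: lat R (e i); last by rewrite -ex opprB addrC subrK.
under eq_bigr do rewrite scaleNr scaler_suml.
rewrite sumrN (exchange_big_dep xpredT)//=; congr (- _); apply: eq_bigr => i _.
have [ei|ei] := boolP (e i \in weights_neg J xi p).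
  rewrite big_mkcond (bigD1_seq (e i)) ?fset_uniq//= eqxx big1 ?addr0// => w.
  by rewrite eq_sym => /negbTE ->.
have -> : c i = 0; last by rewrite scale0r big1// => w _; rewrite scale0r.
apply: h; rewrite lt_neqAle eq_sym (frame_neq0 i fr) leNgt.
by apply: contra ei => ei; apply/(mem_weightsP _ _ fr); exists i.
Qed.

Lemma flow_up_self (p : fixpt M) : flow_up J xi p (val p).
Proof. by exists (fun=> 0); rewrite big1 ?addr0// => w _; rewrite scale0r. Qed.

(** Some edge at q points towards p and lowers mu. It stays in F_p because F_p is a face: its
    direction has a positive coefficient in mom q - mom p. *)
Lemma flow_up_descent (p q : fixpt M) : flow_up J xi p (val q) -> q != p ->
  exists r, [/\ edge r q, mu xi r < mu xi q & flow_up J xi p (val r)].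
Proof.
move=> pq qp; have [e [d fr]] := frame_exists p; have [_ [_ ex] cone _] := fr.
have [f [g frq]] := frame_exists q; have [_ [_ exq] coneq _] := frq.
(* Coordinates of mom p - mom q along W_p^+ vanish; the others are nonnegative and multiply negative
   values of weights. *)
have mupq : mu xi p < mu xi q.
  have [_ inj] := hgen; rewrite lt_neqAle; apply/andP; split.
    by apply: contra qp => /eqP/inj ->.
  rewrite -subr_le0 -pairingNl -pairingDl [_ - _]ex pairing_suml.
  apply: sumr_le0 => i _.
  rewrite pairingZl; have [ei|ei] := ltP 0 (pairing (lat R (e i)) xi).
    by rewrite ((flow_upP q fr).1 pq)// mul0r.
  by rewrite mulr_ge0_le0// cone//; exact: mom_polytope.
pose c j := pairing (mom q - mom p) (lat R (g j)).
have c0 j : 0 <= c j by apply: coneq; exact: mom_polytope.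
(* Otherwise no term of mu q - mu p would be positive. *)
have [j cj fj] : exists2 j, 0 < c j & 0 < pairing (lat R (f j)) xi.
  apply: contrapT => no; move: mupq; apply/negP; rewrite -leNgt.
  rewrite -subr_le0 -pairingNl -pairingDl [_ - _]exq pairing_suml.
  apply: sumr_le0 => j _.
  rewrite pairingZl; have [fj|fj] := ltP 0 (pairing (lat R (f j)) xi).
    suff /eqP : c j == 0 by rewrite /c => ->; rewrite mul0r.
    by rewrite eq_le c0 andbT leNgt; apply/negP => cj; apply: no; exists j.
  by rewrite mulr_ge0_le0// c0.
have [r [t [t0 er rq]]] := edge_ray j frq.
exists r; split=> //.
  by rewrite /mu er !pairing_simp gtrBl mulr_gt0.
apply/(flow_upP r fr) => i ei.
have pqi := (flow_upP q fr).1 pq i ei.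
(* The neighbour of q along -f_k lies in the cone at p, and the i-th coordinate is zero at q. *)
have fd k : 0 <= pairing (lat R (f k)) (lat R (d i)).
  have [q' [t' [t'0 eq' _]]] := edge_ray k frq.
  have := cone _ (mom_polytope q') i.
  by rewrite eq' opprB addrCA pairingDl pqi addr0 pairingZl pmulr_rge0.
have sum0 : \sum_k c k * pairing (lat R (f k)) (lat R (d i)) = 0.
  under eq_bigr do rewrite -pairingZl.
  by rewrite -pairing_suml -exq -opprB pairingNl pqi oppr0.
have /eqP : c j * pairing (lat R (f j)) (lat R (d i)) = 0.
  by apply: (psumr_eq0P _ sum0) => // k _; exact: mulr_ge0.
rewrite mulf_eq0 gt_eqF//= => /eqP fdj.
by rewrite er opprB addrCA pairingDl pqi pairingZl fdj mulr0 addr0.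
Qed.

(** Strong induction on lambda_q: a descending edge inside F_p lowers lambda, and its lower end is p
    or falls under the induction hypothesis. *)
Lemma flow_up_lambda (p q : fixpt M) : index_increasing J xi ->
  flow_up J xi p (val q) -> q != p -> (lambda J xi p < lambda J xi q)%N.
Proof.
move=> hinc; have [k] := ubnP (lambda J xi q).
elim: k q => // k IHk q qk pq qp.
have [r [rq murq pr]] := flow_up_descent pq qp.
have rlq := hinc r q rq murq.
have [<-//|rp] := eqVneq r p.
apply: (ltn_trans _ rlq); apply: IHk => //.
exact: leq_trans rlq _.
Qed.

(** * The restriction of the Poincaré dual to p *)

(** Taking weights is a bijection from the edges at p leaving F_p to W_p^+. *)
Lemma edge_weight_prod (A : comRingType) (F : 'rV[int]_n -> A) (p : fixpt M) :
  \prod_(r <- fset_set [set r : fixpt M | ~ flow_up J xi p (val r) /\ edge r p])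
     F (edge_weight r p) = \prod_(w <- weights_pos J xi p) F w.
Proof.
have [e [d fr]] := frame_exists p; have [_ de _ _] := fr.
set S := [set r | _].
have finS : finite_set S := sub_finite_set (@subsetT _ S) finite_fixpt.
have SP r : S r -> exists i t, [/\ 0 < t, mom r = mom p - t *: lat R (e i),
    edge_weight r p = e i & 0 < pairing (lat R (e i)) xi].
  move=> [nup rp]; have [i [t [t0 er]]] := edge_frame fr rp.
  exists i, t; split=> //; first exact: edge_weight_frame fr t0 er.
  (* An edge along a weight that is not positive keeps all coordinates along W_p^+ zero, so it ends
     in F_p. *)
  rewrite ltNge; apply/negP => ei; apply: nup; apply/(flow_upP r fr) => j ej.
  rewrite er subKr pairingZl de.1; case: eqP => [ji|_]; last by rewrite mulr0.
  by move: ej; rewrite ji ltNge ei.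
rewrite -(big_map (fun r => edge_weight r p) xpredT F); apply: perm_big.
apply: uniq_perm; last 1 first.
- move=> w; apply/mapP/(mem_weightsP _ _ fr).
    move=> [r]; rewrite in_fset_set// => /set_mem /SP[i [t [_ _ rw ei]]] ->.
    by exists i.
  move=> [i -> ei]; have [r [t [t0 er rp]]] := edge_ray i fr.
  exists r; last by rewrite (edge_weight_frame fr t0 er).
  rewrite in_fset_set//; apply/mem_set; split=> //.
  (* The i-th coordinate of mom p - mom r is t > 0, so r is outside F_p. *)
  move=> /(flow_upP r fr)/(_ i ei); rewrite er subKr pairingZl de.1 eqxx mulr1.
  by move=> t00; rewrite t00 ltxx in t0.
- rewrite map_inj_in_uniq ?fset_uniq// => r r'.
  rewrite !in_fset_set// => /set_mem Sr /set_mem Sr'.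
  have [i [t [t0 er -> _]]] := SP _ Sr.
  have [j [t' [t'0 er' -> _]]] := SP _ Sr'.
  move=> /(dual_bases_inj de) ij; rewrite -ij in er'.
  exact: (edge_ray_inj fr Sr.2 Sr'.2 er er').
- exact: fset_uniq.
Qed.

End delzant.

Unset Implicit Arguments.

(* delzant_polytope is the classical description of psi(M); unique renders
   "the" GT-canonical class, whose uniqueness is a theorem of Goldin-Tolman. *)
Theorem proposition4p10 (R : realType) (n : nat) (M : toric_manifold R n)
    (J : invariant_acs M) (hM : delzant_polytope J)
    (xi : 'rV[R]_n) (hgen : generic J xi) (hinc : index_increasing J xi)
    (E : universal_bundle R n) (p : fixpt M) (eta zeta : equivariant_class M E)
    (heta : poincare_dual J xi p eta)
    (hzeta : unique (@GT_canonical R n M J xi E p) zeta) :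
  eta = zeta.
Proof.
(* It suffices that [eta] satisfies the conditions of a GT-canonical class. *)
have [_ uniq_zeta] := hzeta; symmetry; apply: uniq_zeta.
have [deg out inn] := heta; split=> //.
  rewrite inn; last exact: flow_up_self.
  congr (sym_class E _); exact: edge_weight_prod.
(* A fixed point q != p of F_p has lambda_q > lambda_p, so this q lies outside F_p, where [eta]
   restricts to zero. *)
move=> q qp lqp; apply: out => pq.
by have := flow_up_lambda hM hgen hinc pq qp; rewrite ltnNge lqp.
Qed.
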